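(* Let $X$ be a proper CAT$(-1)$ space, let $\Gamma\le\operatorname{Isom}(X)$ be finitely generated, non-elementary and discrete with $0<\delta_X(\Gamma)<\infty$, and let $o\in X$. Let $a_1,\dots,a_k\in\Gamma$ be axial isometries freely generating a rank-$k$ subgroup, $k\ge2$. Set $\tau_i=\tau_X(a_i)$, $r_i(o)=d(o,\operatorname{Ax}(a_i))$ and $\delta=\delta_X(\Gamma)$. Then $$\sum_{i=1}^k\frac{2e^{-2\delta r_i(o)}}{e^{\delta\tau_i}-1+2e^{-2\delta r_i(o)}}\le1.$$ If $\tau_i\le T$ for all $i$ and some point of $X$ lies within distance $R$ of every axis $\operatorname{Ax}(a_i)$, then $$\delta(T+2R)\ge\log(2k-1).$$ The same conclusion holds with $R=\inf_{y\in X}\max_i d(y,\operatorname{Ax}(a_i))$.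
   Context: $\delta_X(\Gamma)=\inf\{s>0:\sum_{g\in\Gamma}e^{-sd(o,go)}<\infty\}$ (independent of $o$). An isometry $g$ is axial (hyperbolic) if its translation length $\tau_X(g)=\inf_{z\in X}d(z,gz)$ is positive and attained; it then preserves a unique geodesic axis $\operatorname{Ax}(g)$. *)

(* Defs.v *)
From HB Require Import structures.
From mathcomp Require Import all_boot all_order all_algebra.
From mathcomp Require Import all_classical all_reals all_analysis.

Set Implicit Arguments.
Unset Strict Implicit.
Unset Printing Implicit Defensive.

Import Order.TTheory GRing.Theory Num.Theory.
Import numFieldNormedType.Exports.

Local Open Scope classical_set_scope.
Local Open Scope ring_scope.

(** * The hyperbolic plane (hyperboloid model) *)

Section Hyperbolic_plane.
Variable R : realType.

Definition arcosh (x : R) : R := ln (x + Num.sqrt (x ^+ 2 - 1)).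

Definition lorentz (u v : 'rV[R]_3) : R :=
  \sum_(i < 3) (if i == ord0 then - (u 0 i * v 0 i) else u 0 i * v 0 i).

Definition hyperboloid : set 'rV[R]_3 :=
  [set u | lorentz u u = -1 /\ 0 < u 0 ord0].

Definition hdist (u v : 'rV[R]_3) : R := arcosh (- lorentz u v).

End Hyperbolic_plane.

(** * Metric geometry *)

Section Metric_geometry.
Variables (R : realType) (X : metricType R).

(* [c] is used only on the set [I]; its values elsewhere are irrelevant. *)
Definition isometric_on (I : set R) (c : R -> X) : Prop :=
  forall s t, I s -> I t -> mdist (c s) (c t) = `|s - t|.

Definition geodesic_path (p q : X) (l : R) (c : R -> X) : Prop :=
  [/\ 0 <= l, c 0 = p, c l = q & isometric_on `[0, l] c].

Definition geodesic_segment (p q : X) (S : set X) : Prop :=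
  exists l c, geodesic_path p q l c /\ S = c @` `[0, l].

Definition geodesic_ray (c : R -> X) : Prop := isometric_on `[0, +oo[ c.

Definition geodesic_line (L : set X) : Prop :=
  exists2 c : R -> X, isometric_on setT c & L = range c.

Definition geodesic_space : Prop :=
  forall p q : X, exists S, geodesic_segment p q S.

Definition proper_space : Prop :=
  forall (x : X) (r : R), compact [set y | mdist x y <= r].

(* Side [i] of a geodesic triangle joins vertex [i] to vertex [ordS i], the
   indices being cyclic modulo 3. *)
Definition geodesic_triangle (v : 'I_3 -> X) (S : 'I_3 -> set X) : Prop :=
  forall i, geodesic_segment (v i) (v (ordS i)) (S i).

Definition comparison_triangle (v : 'I_3 -> X) (w : 'I_3 -> 'rV[R]_3) : Prop :=
  (forall i, hyperboloid (w i)) /\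
  (forall i j, hdist (w i) (w j) = mdist (v i) (v j)).

(* [u] is the point of the hyperbolic segment from [w i] to [w (ordS i)] that
   corresponds to the point [x] of side [i]. *)
Definition comparison_point (v : 'I_3 -> X) (w : 'I_3 -> 'rV[R]_3)
    (i : 'I_3) (x : X) (u : 'rV[R]_3) : Prop :=
  [/\ hyperboloid u, hdist (w i) u = mdist (v i) x &
      hdist u (w (ordS i)) = mdist x (v (ordS i))].

Definition CAT_minus1 : Prop :=
  geodesic_space /\
  forall v S w, geodesic_triangle v S -> comparison_triangle v w ->
  forall i j x y ux uy, S i x -> S j y ->
    comparison_point v w i x ux -> comparison_point v w j y uy ->
    mdist x y <= hdist ux uy.

Definition dist_set (x : X) (A : set X) : R := inf [set mdist x y | y in A].

End Metric_geometry.

Arguments proper_space {R} X.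
Arguments CAT_minus1 {R} X.

(** * The isometry group *)

Section Isometries.
Variables (R : realType) (X : metricType R).

Record isom : Type := Isom {
  isom_fun :> X -> X;
  isom_surj : forall y, exists x, isom_fun x = y;
  isom_dist : forall x y, mdist (isom_fun x) (isom_fun y) = mdist x y }.

Lemma isomP (g h : isom) : (forall x, g x = h x) -> g = h.
Proof.
case: g h => [f fs fd] [f' fs' fd'] /= /funext ff'.
by subst f'; congr Isom; exact: Prop_irrelevance.
Qed.

Lemma isom_inj (g : isom) : injective g.
Proof.
by move=> x y gxy; apply: mdist_positivity; rewrite -(isom_dist g) gxy mdistxx.
Qed.

HB.instance Definition _ := gen_eqMixin isom.
HB.instance Definition _ := gen_choiceMixin isom.

Definition isom_one : isom :=
  @Isom idfun (fun y => ex_intro _ y erefl) (fun _ _ => erefl).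

Definition isom_mul (g h : isom) : isom.
Proof.
exists (g \o h).
- move=> y; have [x gx] := isom_surj g y; have [z hz] := isom_surj h x.
  by exists z; rewrite /= hz.
- by move=> x y; rewrite /= !isom_dist.
Defined.

Definition isom_inv_fun (g : isom) (y : X) : X := sval (cid (isom_surj g y)).

Lemma isom_inv_funK (g : isom) : cancel (isom_inv_fun g) g.
Proof. by move=> y; rewrite /isom_inv_fun; case: cid. Qed.

Lemma isom_funK (g : isom) : cancel g (isom_inv_fun g).
Proof. by move=> x; apply: (@isom_inj g); rewrite isom_inv_funK. Qed.

Definition isom_inv (g : isom) : isom.
Proof.
exists (isom_inv_fun g).
- by move=> x; exists (g x); rewrite isom_funK.
- by move=> x y; rewrite -(isom_dist g) !isom_inv_funK.
Defined.

Let isom_mulA : associative isom_mul.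
Proof. by move=> g h k; apply: isomP. Qed.
Let isom_1mul : left_id isom_one isom_mul.
Proof. by move=> g; apply: isomP. Qed.
Let isom_mul1 : right_id isom_one isom_mul.
Proof. by move=> g; apply: isomP. Qed.
Let isom_Vmul : left_inverse isom_one isom_inv isom_mul.
Proof. by move=> g; apply: isomP => x /=; exact: isom_funK. Qed.
Let isom_mulV : right_inverse isom_one isom_inv isom_mul.
Proof. by move=> g; apply: isomP => x /=; exact: isom_inv_funK. Qed.

HB.instance Definition _ :=
  isGroup.Build isom isom_mulA isom_1mul isom_mul1 isom_Vmul isom_mulV.

End Isometries.

(** * Subgroups of a (possibly infinite) group *)

Section Group_theory.
Variable G : groupType.

Definition is_subgroup (H : set G) : Prop := group_closed [in H].

Definition finitely_generated (H : set G) : Prop :=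
  exists2 S : set G, finite_set S & H = smallest is_subgroup S.

(* The letter [(i, b)] stands for [a i] if [b], and for its inverse if not. *)
Definition letter_value (k : nat) (a : 'I_k -> G) (l : 'I_k * bool) : G :=
  if l.2 then a l.1 else ((a l.1)^-1)%g.

Definition reduced_word (k : nat) (w : seq ('I_k * bool)) : bool :=
  sorted (fun l m => ~~ ((l.1 == m.1) && (l.2 != m.2))) w.

(* The natural map from the free group on [k] letters to [G] is injective. *)
Definition freely_generating (k : nat) (a : 'I_k -> G) : Prop :=
  forall w : seq ('I_k * bool), reduced_word w ->
    (\prod_(l <- w) letter_value a l)%g = 1%g -> w = [::].

End Group_theory.

(** * Groups of isometries *)

Section Isometry_groups.
Variables (R : realType) (X : metricType R).
Implicit Types (Gamma : set (isom X)) (o : X) (g : isom X).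

(* [Gamma] is discrete in the compact-open topology. *)
Definition discrete_isoms Gamma : Prop :=
  let Gamma_fun : set {compact-open, X -> X} := @isom_fun R X @` Gamma in
  Gamma_fun `<=` isolated Gamma_fun.

(* The points of the boundary at infinity are represented by the geodesic rays
   from [o]. Such a ray represents a limit point when some sequence of orbit
   points [g n o] converges to its endpoint in the cone topology: the segments
   from [o] to [g n o] become arbitrarily long and converge to the ray. *)
Definition limit_ray o Gamma (c : R -> X) : Prop :=
  [/\ geodesic_ray c, c 0 = o &
      exists (g : nat -> isom X) (l : nat -> R) (s : nat -> R -> X),
        [/\ forall n, Gamma (g n),
            forall n, geodesic_path o (g n o) (l n) (s n),
            l n @[n --> \oo] --> +oo &
            forall t, 0 <= t -> s n t @[n --> \oo] --> c t]].

Definition asymptotic (c c' : R -> X) : Prop :=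
  exists B : R, forall t, 0 <= t -> mdist (c t) (c' t) <= B.

(* The limit set has at least three points. *)
Definition non_elementary o Gamma : Prop :=
  exists c : 'I_3 -> R -> X, (forall i, limit_ray o Gamma (c i)) /\
    (forall i j, i != j -> ~ asymptotic (c i) (c j)).

Definition critical_exponent o Gamma : \bar R :=
  ereal_inf [set s%:E | s in [set s : R | 0 < s /\
    (\esum_(g in Gamma) (expR (- s * mdist o (g o)))%:E < +oo)%E]].

Definition translation_length g : R := inf [set mdist z (g z) | z in setT].

Definition axial g : Prop :=
  0 < translation_length g /\ exists z, mdist z (g z) = translation_length g.

Definition is_axis g (L : set X) : Prop := geodesic_line L /\ g @` L = L.

(* The unique axis when [g] is axial. *)
Definition axis g : set X := xget set0 (is_axis g).

End Isometry_groups.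

(* Main.v *)
Require Import Defs.
From HB Require Import structures.
From mathcomp Require Import all_boot all_order all_algebra.
From mathcomp Require Import all_classical all_reals all_analysis.
From mathcomp Require Import ring lra.

Set Implicit Arguments.
Unset Strict Implicit.
Unset Printing Implicit Defensive.

Import Order.TTheory GRing.Theory Num.Theory.
Import numFieldNormedType.Exports.

Local Open Scope classical_set_scope.
Local Open Scope ring_scope.

(** The first inequality comes from counting in the free group.
Fix [s] with a convergent Poincare series and points [y i] of the axes, at
distance [rho i] from [o].  Write a reduced word as a product of syllables
[a_i^n].  A path from [o] that, for each syllable, walks to [y i], follows the
axis for [|n|] steps of length [tau i] and comes back to [o], shows that the
word moves [o] by at most the sum over its syllables of
[2 rho i + |n| tau i] ([mdist_word_le]).  Distinct reduced words are distinct
elements of [Gamma] ([reduced_word_prod_inj]), so the series of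
[e^(- s * this bound)] over all reduced
words converges.  With [x i] the sum over the nonzero powers of [a i],
[x i = 2 e^(-2 s rho i) / (e^(s tau i) - 1)], that series is the one of a free
product, [1 / (1 - \sum_i x i / (1 + x i))], and its convergence forces
[\sum_i x i / (1 + x i) <= 1], which is the stated inequality at [s] and [rho].

The geometric series are never summed.  Letter by letter, the sums [p l] over
the reduced words with first letter [l] satisfy a linear system
([partial_sumS]), and solving it gives the inequality
([axis_sum_le1_of_fixpoint]).  As the terms decrease in [s] and in [rho], one
may then let [s] tend to the critical exponent and [rho i] to the distance from
[o] to the axis ([sum_axis_term_le1]).

The other two conclusions follow because the critical exponent does not depend
on the base point: moving [o] to a point within [D] of all the axes bounds every
term from below by its value at [T] and [D], and [k] times this value is at most
1.  The infimum case is this one at every point of the space, since the bound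
obtained is equivalent to a lower bound on [D].

Curvature enters through the existence of the axes.  The segment joining the midpoints of
[[y, g y]] and [[g y, g (g y)]] has length at most half of the distance from [y]
to [g (g y)], by comparison with a hyperbolic isosceles triangle
([midpoint_comparison]).  Hence squaring an isometry at least doubles its
minimal displacement, so that a point [z] moved minimally by an axial [g]
satisfies [d(z, g^n z) = n tau] for all [n]; the translates of a geodesic
from [z] to [g z] therefore fit together into an invariant line
([axis_exists]). *)

(** * Hyperbolic trigonometry *)

Section Hyperbolic_cosine.
Variable R : realType.
Implicit Types a b t x y : R.

Definition cosh t : R := (expR t + expR (- t)) / 2.

Lemma cosh0 : cosh 0 = 1.
Proof. by rewrite /cosh oppr0 expR0; field. Qed.

Lemma cosh_double t : cosh t = 2 * cosh (t / 2) ^+ 2 - 1.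
Proof.
have e : expR t = expR (t / 2) ^+ 2 by rewrite expr2 -expRD -splitr.
rewrite /cosh !expRN e; field; exact: lt0r_neq0 (expR_gt0 _).
Qed.

Lemma cosh_ge1 t : 1 <= cosh t.
Proof.
rewrite /cosh expRN; have e0 := expR_gt0 t; set e := expR t in e0 *.
rewrite -subr_ge0.
have -> : (e + e^-1) / 2 - 1 = (e - 1) ^+ 2 / (2 * e).
  by field; exact: lt0r_neq0.
by rewrite divr_ge0 ?sqr_ge0 // mulr_ge0 // ltW.
Qed.

Lemma le_cosh a b : 0 <= a -> a <= b -> cosh a <= cosh b.
Proof.
move=> a0 ab; rewrite /cosh !expRN.
have : 1 <= expR a by rewrite -expR0 ler_expR.
have : expR a <= expR b by rewrite ler_expR.
move: (expR a) (expR b) => x y xy x1.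
rewrite -subr_ge0.
have -> : (y + y^-1) / 2 - (x + x^-1) / 2 = (y - x) * (x * y - 1) / (2 * x * y).
  by field; rewrite !lt0r_neq0 //; lra.
by rewrite divr_ge0 ?mulr_ge0 ?subr_ge0 //; nra.
Qed.

Lemma arcosh_cosh t : 0 <= t -> arcosh (cosh t) = t.
Proof.
move=> t0; rewrite /arcosh.
have -> : cosh t ^+ 2 - 1 = ((expR t - expR (- t)) / 2) ^+ 2.
  by rewrite /cosh expRN; field; exact: lt0r_neq0 (expR_gt0 _).
have st : expR (- t) <= expR t by rewrite ler_expR; lra.
rewrite sqrtr_sqr ger0_norm; last by lra.
by rewrite -[RHS](@expRK R); congr ln; rewrite /cosh; field.
Qed.

Lemma le_arcosh x y : 1 <= x -> x <= y -> arcosh x <= arcosh y.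
Proof.
move=> x1 xy; rewrite /arcosh ler_ln ?posrE; first last.
- by rewrite ltr_pwDl ?sqrtr_ge0 //; lra.
- by rewrite ltr_pwDl ?sqrtr_ge0 //; lra.
by rewrite lerD // ler_wsqrtr // lerD2r ler_sqr ?nnegrE //; lra.
Qed.

End Hyperbolic_cosine.

Section Vectors.
Variable R : realType.

Definition vec3 (x y z : R) : 'rV[R]_3 := \row_i nth 0 [:: x; y; z] i.

Lemma lorentz_vec3 x y z x' y' z' :
  lorentz (vec3 x y z) (vec3 x' y' z') = - (x * x') + y * y' + z * z'.
Proof. by rewrite /lorentz !big_ord_recr big_ord0 /= !mxE /= add0r. Qed.

Lemma hdist_vec3 (t x y z x' y' z' : R) : 0 <= t ->
  x * x' - y * y' - z * z' = cosh t -> hdist (vec3 x y z) (vec3 x' y' z') = t.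
Proof.
move=> t0 e; rewrite /hdist lorentz_vec3 -[RHS]arcosh_cosh // -e.
by congr arcosh; ring.
Qed.

Lemma hyperboloid_vec3 (x y z : R) : 0 < x -> x ^+ 2 - y ^+ 2 - z ^+ 2 = 1 ->
  hyperboloid (vec3 x y z).
Proof.
move=> x0 e; split; last by rewrite mxE.
by rewrite lorentz_vec3 -[in RHS]e; ring.
Qed.

End Vectors.

(** * Comparison of midpoints *)

(** The two midpoints of the equal sides are as close in the hyperbolic plane as
half of the base.  The triangle is placed with the midpoint of its base [w0 w2]
at [(1, 0, 0)] and its axis of symmetry in the plane where the second coordinate
vanishes, so that its coordinates come from the hyperbolic Pythagoras relation
[cosh (b / 2) * H = cosh a]; the midpoint of two points of the hyperboloid is
their normalized sum. *)
Lemma isosceles_model (R : realType) (a b : R) : 0 <= b -> b <= a + a ->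
  exists w0 w1 w2 u u' : 'rV[R]_3,
    [/\ [/\ hyperboloid w0, hyperboloid w1, hyperboloid w2, hyperboloid u &
            hyperboloid u'],
        [/\ hdist w0 w0 = 0, hdist w1 w1 = 0 & hdist w2 w2 = 0],
        [/\ hdist w0 w1 = a, hdist w1 w0 = a, hdist w1 w2 = a & hdist w2 w1 = a],
        hdist w0 w2 = b /\ hdist w2 w0 = b &
        [/\ hdist w0 u = a / 2, hdist u w1 = a / 2, hdist w1 u' = a / 2,
            hdist u' w2 = a / 2 & hdist u u' <= b / 2]].
Proof.
move=> b0 bD.
have [a0 a20 b20 ba2] : [/\ 0 <= a, 0 <= a / 2, 0 <= b / 2 & b / 2 <= a].
  by split; lra.
set A := cosh a; set B := cosh (b / 2); set al := cosh (a / 2).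
have B1 : 1 <= B := cosh_ge1 _.
have al1 : 1 <= al := cosh_ge1 _.
have BA : B <= A by exact: le_cosh.
have eA : A = 2 * al ^+ 2 - 1 := cosh_double a.
have eb : cosh b = 2 * B ^+ 2 - 1 := cosh_double b.
have [cA cB cal] : [/\ cosh a = A, cosh (b / 2) = B & cosh (a / 2) = al] by [].
clearbody A B al.
have B0 : 0 < B := lt_le_trans ltr01 B1.
have al0 : 0 < al := lt_le_trans ltr01 al1.
pose sB := Num.sqrt (B ^+ 2 - 1); pose H := A / B; pose sH := Num.sqrt (H ^+ 2 - 1).
have sB2 : sB * sB = B ^+ 2 - 1.
  by rewrite -expr2 sqr_sqrtr // subr_ge0 exprn_ege1.
have BH : B * H = A by rewrite /H mulrC divfK // lt0r_neq0.
have H1 : 1 <= H by rewrite /H ler_pdivlMr ?mul1r.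
have sH2 : sH * sH = H ^+ 2 - 1.
  by rewrite -expr2 sqr_sqrtr // subr_ge0 exprn_ege1.
clearbody sB H sH.
have H0 : 0 < H := lt_le_trans ltr01 H1.
pose w0 := vec3 B sB 0; pose w1 := vec3 H 0 sH; pose w2 := vec3 B (- sB) 0.
(* The Lorentz norm of [w0 + w1] is [2 al], so [h] is what normalizes it. *)
pose h := (2 * al)^-1.
have h0 : 0 < h by rewrite invr_gt0 mulr_gt0.
have ehA : h ^+ 2 * (2 + 2 * A) = 1.
  by rewrite eA /h; field; exact: lt0r_neq0.
have hA1 : h * (1 + A) = al.
  by rewrite eA /h; field; exact: lt0r_neq0.
clearbody h.
pose u := vec3 (h * (B + H)) (h * sB) (h * sH).
pose u' := vec3 (h * (B + H)) (- (h * sB)) (h * sH).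
have hu_gt0 : 0 < h * (B + H) by rewrite mulr_gt0 // addr_gt0.
have hu1 : (h * (B + H)) ^+ 2 - (h * sB) ^+ 2 - (h * sH) ^+ 2 = 1.
  rewrite -ehA -BH !exprMn (expr2 sB) (expr2 sH) sB2 sH2; ring.
exists w0, w1, w2, u, u'; split.
- split; apply: hyperboloid_vec3 => //.
  + by rewrite (expr2 sB) sB2; ring.
  + by rewrite (expr2 sH) sH2; ring.
  + by rewrite sqrrN (expr2 sB) sB2; ring.
  + by rewrite sqrrN.
- split; apply: hdist_vec3; rewrite // cosh0 ?mulrNN ?sB2 ?sH2; ring.
- split; apply: hdist_vec3; rewrite // cA -BH; ring.
- split; apply: hdist_vec3; rewrite // eb ?mulrN ?mulNr sB2; ring.
split.
- apply: hdist_vec3; rewrite // cal -hA1 -BH mulrCA (mulrCA sB) sB2; ring.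
- apply: hdist_vec3; rewrite // cal -hA1 -BH -(mulrA h sH) sH2; ring.
- apply: hdist_vec3; rewrite // cal -hA1 -BH (mulrCA sH) sH2; ring.
- apply: hdist_vec3; rewrite // cal -hA1 -BH mulrNN -(mulrA h sB) sB2; ring.
rewrite -[leRHS]arcosh_cosh // cB /hdist lorentz_vec3.
have -> : - (- (h * (B + H) * (h * (B + H))) + h * sB * - (h * sB) + h * sH * (h * sH))
    = h ^+ 2 * (2 * B ^+ 2 + 2 * A).
  transitivity (h ^+ 2 * ((B + H) ^+ 2 + sB * sB - sH * sH)); first ring.
  rewrite sB2 sH2 -BH; ring.
(* The inequality left reduces to [(B - 1) * (A - B) >= 0], and
   [B <= A] is the triangle inequality [b / 2 <= a]. *)
have h20 : 0 < h ^+ 2 by rewrite exprn_gt0.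
apply: le_arcosh.
- rewrite -[leLHS]ehA ler_wpM2l ?(ltW h20) // lerD2r.
  by rewrite ler_peMr // exprn_ege1.
- rewrite -[leRHS]mulr1 -[X in _ <= _ * X]ehA (mulrCA B) ler_wpM2l ?(ltW h20) //.
  rewrite -subr_ge0.
  have -> : B * (2 + 2 * A) - (2 * B ^+ 2 + 2 * A) = 2 * ((B - 1) * (A - B)).
    ring.
  by rewrite !mulr_ge0 // subr_ge0.
Qed.

Section Midpoints.
Variables (R : realType) (X : metricType R).
Hypothesis hCAT : CAT_minus1 X.

Lemma midpoint_comparison (p q r : X) (a : R) (c c' : R -> X) :
  geodesic_path p q a c -> geodesic_path q r a c' ->
  mdist (c (a / 2)) (c' (a / 2)) <= mdist p r / 2.
Proof.
move=> [a0 c0 ca ciso] [_ c'0 c'a c'iso].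
have m0 : `[0, a]%classic 0 by rewrite /= in_itv /= lexx.
have ma : `[0, a]%classic a by rewrite /= in_itv /= lexx andbT.
have mh : `[0, a]%classic (a / 2) by rewrite /= in_itv /=; apply/andP; split; lra.
have h0 : `|0 - a / 2| = a / 2 by rewrite distrC subr0 ger0_norm; lra.
have ha : `|a / 2 - a| = a / 2 by rewrite distrC ger0_norm; lra.
have da : `|0 - a| = a by rewrite distrC subr0 ger0_norm.
have dpq : mdist p q = a by rewrite -c0 -ca ciso // da.
have dqr : mdist q r = a by rewrite -c'0 -c'a c'iso // da.
have bD : mdist p r <= a + a by rewrite -{1}dpq -dqr; exact: metric_triangle.
have [w0 [w1 [w2 [u [u' [[hw0 hw1 hw2 hu hu'] [d00 d11 d22]]]]]]] :=
  isosceles_model (mdist_ge0 p r) bD.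
move=> [d01 d10 d12 d21] [d02 d20] [d0u du1 d1u' du'2 duu'].
pose v (i : 'I_3) := nth p [:: p; q; r] i.
pose w (i : 'I_3) := nth w0 [:: w0; w1; w2] i.
have [S2 hS2] := hCAT.1 r p.
pose S (i : 'I_3) := nth set0 [:: c @` `[0, a]; c' @` `[0, a]; S2] i.
have tri : geodesic_triangle v S.
  case=> [[|[|[|//]]] ?]; rewrite /v /S /=.
  - by exists a, c.
  - by exists a, c'.
  - exact: hS2.
have cmp : comparison_triangle v w.
  split; first by case=> [[|[|[|//]]] ?].
  case=> [[|[|[|//]]] ?] [[|[|[|//]]] ?]; rewrite /v /w /= ?mdistxx //.
  - by rewrite dpq.
  - by rewrite metric_sym dpq.
  - by rewrite dqr.
  - by rewrite d20 metric_sym.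
  - by rewrite metric_sym dqr.
pose i0 : 'I_3 := Ordinal (isT : (0 < 3)%N).
pose i1 : 'I_3 := Ordinal (isT : (1 < 3)%N).
have S0x : S i0 (c (a / 2)) by exists (a / 2).
have S1y : S i1 (c' (a / 2)) by exists (a / 2).
have cx : comparison_point v w i0 (c (a / 2)) u.
  split=> //; rewrite /v /w /=.
  - by rewrite -c0 ciso // h0.
  - by rewrite -ca ciso // ha.
have cy : comparison_point v w i1 (c' (a / 2)) u'.
  split=> //; rewrite /v /w /=.
  - by rewrite -c'0 c'iso // h0.
  - by rewrite -c'a c'iso // ha.
exact: (le_trans (hCAT.2 _ _ _ tri cmp _ _ _ _ _ _ S0x S1y cx cy)).
Qed.

End Midpoints.

(** * Axes of axial isometries *)

Section Displacement.
Variables (R : realType) (X : metricType R).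
Implicit Types (g h : isom X) (x y z : X).

Lemma isom_mulE g h x : (g * h)%g x = g (h x).
Proof. by []. Qed.

Lemma isom_invK g x : (g^-1)%g (g x) = x.
Proof. exact: isom_funK. Qed.

Lemma translation_length_le g y : translation_length g <= mdist y (g y).
Proof.
apply: ge_inf; last by exists y.
by exists 0 => _ [z _ <-]; exact: mdist_ge0.
Qed.

Lemma mdist_expg_le g y n : mdist y ((g ^+ n)%g y) <= n%:R * mdist y (g y).
Proof.
elim: n => [|n IH]; first by rewrite expg0 mdistxx mul0r.
rewrite expgS isom_mulE -natr1 mulrDl mul1r addrC.
by rewrite (le_trans (metric_triangle _ (g y) _)) // isom_dist lerD2l.
Qed.

Lemma mdist_displacement g y z : mdist y (g y) <= mdist z (g z) + 2 * mdist y z.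
Proof.
have := metric_triangle y z (g y); have := metric_triangle z (g z) (g y).
by rewrite (isom_dist g) (metric_sym z y); lra.
Qed.

(** The midpoint [m] of [[y, g y]] is moved by [g] to the midpoint of
[[g y, g (g y)]], so [t <= d(m, g m) <= d(y, g (g y)) / 2]. *)
Lemma le_displacement_sqr (hCAT : CAT_minus1 X) g (t : R) :
  (forall y, t <= mdist y (g y)) ->
  forall y, 2 * t <= mdist y ((g * g)%g y).
Proof.
move=> ht y; have [_ [l [c [[l0 c0 cl ciso] _]]]] := hCAT.1 y (g y).
have pc : geodesic_path y (g y) l c by [].
have pgc : geodesic_path (g y) ((g * g)%g y) l (g \o c).
  split=> //=; [by rewrite c0|by rewrite cl|].
  by move=> s u Is Iu; rewrite /= isom_dist ciso.
have := midpoint_comparison hCAT pc pgc; have := ht (c (l / 2)).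
rewrite /=; lra.
Qed.

Lemma le_displacement_expg2n (hCAT : CAT_minus1 X) g (t : R) n :
  (forall y, t <= mdist y (g y)) ->
  forall y, 2 ^+ n * t <= mdist y ((g ^+ (2 ^ n)%N)%g y).
Proof.
elim: n => [|n IH] in g t *; first by move=> ht y; rewrite mul1r; exact: ht.
move=> ht y; rewrite expnS expgnA expg2 exprSr -mulrA.
by apply: IH => {}y; exact: le_displacement_sqr.
Qed.

(** For powers of two the lower bound is iterated doubling; any smaller exponent
inherits it, since a shorter orbit segment that saved distance would make the
whole segment up to the power of two save distance as well. *)
Lemma mdist_expg_minimal (hCAT : CAT_minus1 X) g z n :
  mdist z (g z) = translation_length g ->
  mdist z ((g ^+ n)%g z) = n%:R * translation_length g.
Proof.
move=> hz; apply/eqP; rewrite eq_le -{1}hz mdist_expg_le /=.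
have := le_displacement_expg2n hCAT n (translation_length_le g) z.
have n2 : (n <= 2 ^ n)%N by rewrite ltnW // ltn_expl.
rewrite -[in (2 ^ n)%N](subnKC n2) expgnDr isom_mulE.
have := metric_triangle z ((g ^+ n)%g z) ((g ^+ n)%g ((g ^+ (2 ^ n - n))%g z)).
have := mdist_expg_le g z (2 ^ n - n).
rewrite isom_dist hz natrB // natrX mulrBl; lra.
Qed.

End Displacement.

Section Integer_powers.
Variable G : groupType.

Definition expgz (g : G) (m : int) : G :=
  match m with Posz n => g ^+ n | Negz n => g ^- n.+1 end%g.

Lemma expgzSr g m : expgz g (m + 1) = (expgz g m * g)%g.
Proof.
case: m => [n|[|n]] /=.
- by rewrite addn1 expgSr.
- by rewrite expg1 mulVg expg0.
- by rewrite subn1 [(g ^+ n.+2)%g]expgS invgM mulgVK.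
Qed.

Lemma expgzS g m : expgz g (m + 1) = (g * expgz g m)%g.
Proof.
case: m => [n|[|n]] /=.
- by rewrite addn1 expgS.
- by rewrite expg1 mulgV expg0.
- by rewrite subn1 [(g ^+ n.+2)%g]expgSr invgM mulVKg.
Qed.

Lemma expgzDn g m (n : nat) : expgz g (m + n%:Z) = (expgz g m * g ^+ n)%g.
Proof.
elim: n => [|n IH]; first by rewrite addr0 expg0 mulg1.
by rewrite -addn1 PoszD addrA expgzSr IH addn1 expgSr mulgA.
Qed.

End Integer_powers.

Section Axis.
Variables (R : realType) (X : metricType R).
Hypothesis hCAT : CAT_minus1 X.
Implicit Types (g h : isom X) (x y z : X).

(** The line is the union of the translates under [g^m], [m] an integer, of a
geodesic from a minimally displaced point [z] to [g z].  The path so obtained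
does not increase distances, and it cannot decrease them because the orbit points
[p m] of [z] are at distance exactly [|m - n| t]. *)
Lemma axis_exists g : axial g -> exists L, is_axis g L.
Proof.
case=> t0 [z hz]; set t := translation_length g in t0 hz.
have [_ [l [c [[l0 c0 cl ciso] _]]]] := hCAT.1 z (g z).
have el : l = t.
  rewrite -hz -cl -{1}c0 ciso /= ?in_itv /= ?lexx ?l0 //.
  by rewrite distrC subr0 ger0_norm.
subst l.
pose fl (s : R) := Num.floor (s / t).
pose p (m : int) : X := expgz g m z.
pose f (s : R) : X := expgz g (fl s) (c (s - (fl s)%:~R * t)).
have flP s : (fl s)%:~R * t <= s < ((fl s)%:~R + 1) * t.
  by rewrite -ler_pdivlMr // -ltr_pdivrMr // floor_le /= -intrD1 floorD1_gt.
have pS m : p (m + 1) = expgz g m (g z) by rewrite /p expgzSr.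
have dp m n : m <= n -> mdist (p m) (p n) = (n - m)%:~R * t.
  move=> mn; have [j ->] : exists j : nat, n = m + j%:Z.
    by exists `|n - m|%N; rewrite gez0_abs ?subr_ge0 // subrKC.
  by rewrite /p expgzDn isom_mulE isom_dist mdist_expg_minimal // addrC addKr.
have I0 : `[0, t]%classic 0 by rewrite /= in_itv /= lexx ltW.
have It : `[0, t]%classic t by rewrite /= in_itv /= lexx ltW.
have If s : `[0, t]%classic (s - (fl s)%:~R * t).
  have /andP[s1 s2] := flP s.
  by rewrite /= in_itv /= subr_ge0 s1 /=; lra.
have dl s : mdist (p (fl s)) (f s) = s - (fl s)%:~R * t.
  have /andP[s1 s2] := flP s.
  by rewrite /p /f isom_dist -[z in mdist z]c0 ciso // distrC subr0 ger0_norm // subr_ge0.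
have dr s : mdist (f s) (p (fl s + 1)) = ((fl s)%:~R + 1) * t - s.
  have /andP[s1 s2] := flP s.
  by rewrite pS /f isom_dist -cl ciso // distrC ger0_norm; [ring|lra].
have df s u : s <= u -> mdist (f s) (f u) = u - s.
  move=> su.
  have mn : fl s <= fl u by apply: le_floor; rewrite ler_pM2r // invr_gt0.
  have dmn : mdist (p (fl s)) (p (fl u + 1)) = ((fl u)%:~R + 1 - (fl s)%:~R) * t.
    by rewrite dp ?intrB ?intrD // (le_trans mn) // lerDl.
  apply/eqP; rewrite eq_le; apply/andP; split; last first.
    have := metric_triangle (p (fl s)) (f s) (p (fl u + 1)).
    have := metric_triangle (f s) (f u) (p (fl u + 1)).
    by rewrite dmn dl dr; lra.
  have [eqf|/eqP nef] := eqVneq (fl s) (fl u).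
    have /andP[s1 s2] := flP s; have /andP[u1 u2] := flP u.
    by rewrite /f eqf isom_dist ciso // -?eqf // distrC ger0_norm; lra.
  have mn1 : fl s + 1 <= fl u by rewrite lezD1 lt_neqAle mn andbT; apply/eqP.
  have := metric_triangle (f s) (p (fl s + 1)) (f u).
  have := metric_triangle (p (fl s + 1)) (p (fl u)) (f u).
  by rewrite dl dr dp // intrB intrD; lra.
have gf s : g (f s) = f (s + t).
  have e : fl (s + t) = fl s + 1.
    by rewrite /fl mulrDl divff ?lt0r_neq0 // floorDrz ?floor1 // rpred1.
  rewrite /f e expgzS isom_mulE; congr (g (expgz g _ (c _))).
  by rewrite intrD; ring.
exists (range f); split.
  exists f => // s u _ _; have [su|/ltW us] := leP s u.
    by rewrite df // distrC ger0_norm // subr_ge0.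
  by rewrite metric_sym df // ger0_norm // subr_ge0.
apply/seteqP; split=> [_ [_ [s _ <-] <-]|_ [s _ <-]].
- by exists (s + t); rewrite // gf.
- by exists (f (s - t)); [exists (s - t)|rewrite gf subrK].
Qed.

Lemma axisP g : axial g -> is_axis g (axis g).
Proof. by move=> /axis_exists; exact: xgetPex. Qed.

(** Three points [y], [h y], [h (h y)] of a line with equal consecutive distances
either advance in one direction or the third is the first. *)
Lemma geodesic_line_displacement_sqr (L : set X) h y :
  geodesic_line L -> (forall x, L x -> L (h x)) -> L y ->
  0 < mdist y ((h * h)%g y) -> mdist y ((h * h)%g y) = 2 * mdist y (h y).
Proof.
move=> [c ciso ->] hL Ly; have Lhy := hL _ Ly.
have [s _ es] := Ly; have [s' _ es'] := Lhy; have [s'' _ es''] := hL _ Lhy.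
have d1 : mdist y (h y) = `|s - s'| by rewrite -es' -es ciso.
have d2 : mdist y (h y) = `|s' - s''|.
  by rewrite -(isom_dist h) -es'' -es' ciso.
have d3 : mdist y ((h * h)%g y) = `|s - s''| by rewrite isom_mulE -es'' -es ciso.
rewrite d3 d1; move: d2; rewrite d1 => /eqP; rewrite eqr_norm2.
case/orP => /eqP e; last first.
  have -> : s - s'' = 0 by lra.
  by rewrite normr0 ltxx.
have -> : s - s'' = 2 * (s - s') by lra.
by rewrite normrM ger0_norm.
Qed.

(** On any invariant line the displacement of the powers [g^(2^n)] is [2^n] times
that of [g], while it differs by a bounded amount from the displacement
[2^n * tau] of a minimally displaced point; dividing by [2^n] compares the
two. *)
Lemma mdist_axis g y : axial g -> axis g y ->
  mdist y (g y) = translation_length g.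
Proof.
move=> ag ay; have [Lax gL] := axisP ag; case: ag => t0 [z hz].
set t := translation_length g in t0 hz *.
have Lpow n x : axis g x -> axis g ((g ^+ n)%g x).
  elim: n => // n IH Lx; rewrite expgS isom_mulE -gL; exists ((g ^+ n)%g x) => //.
  exact: IH.
have dpow n : mdist y ((g ^+ (2 ^ n)%N)%g y) = 2 ^+ n * mdist y (g y).
  elim: n => [|n IH]; first by rewrite expn0 expr0 mul1r expg1.
  rewrite expnSr expgnA expg2 (geodesic_line_displacement_sqr Lax) //.
  - by rewrite IH exprS mulrA.
  - exact: Lpow.
  - have := le_displacement_expg2n hCAT n.+1 (translation_length_le g) y.
    rewrite expnSr expgnA expg2; apply: lt_le_trans.
    by rewrite mulr_gt0 // exprn_gt0.
apply/eqP; rewrite eq_le translation_length_le andbT -/t.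
rewrite leNgt; apply/negP => ty.
set e := mdist y (g y) - t; have e0 : 0 < e by rewrite subr_gt0.
pose n := Num.bound (2 * mdist y z / e).
have le_n : 2 ^+ n * e <= 2 * mdist y z.
  have := mdist_displacement (g ^+ (2 ^ n)%N)%g y z.
  by rewrite dpow (mdist_expg_minimal hCAT) // natrX /e; lra.
have lt_n : 2 * mdist y z < n%:R * e.
  rewrite -ltr_pdivrMr //.
  by apply: archi_boundP; rewrite divr_ge0 ?mulr_ge0 ?mdist_ge0 // ltW.
have : n%:R * e < 2 ^+ n * e by rewrite ltr_pM2r // -natrX ltr_nat ltn_expl.
lra.
Qed.

End Axis.

(** * Reduced words *)

Section Reduced_words.
Variables (k : nat).
Implicit Types (l m : 'I_k * bool) (w : seq ('I_k * bool)).

Definition inverse_letter l : 'I_k * bool := (l.1, ~~ l.2).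

(** The adjacency condition of [reduced_word]. *)
Definition compatible l m : bool := ~~ ((l.1 == m.1) && (l.2 != m.2)).

Lemma compatibleE l m : compatible l m = (m != inverse_letter l).
Proof.
case: l m => [i b] [j c]; rewrite /compatible /inverse_letter xpair_eqE /= eq_sym.
by case: eqP => //= _; case: b c => [] [].
Qed.

(** [n] bounds the number of letters.  These are lists rather than sets, so that
sums over them unfold along the recursion. *)
Fixpoint words_from (n : nat) l : seq (seq ('I_k * bool)) :=
  if n is n'.+1 then
    [:: l] :: [seq l :: w | m <- [seq m <- enum {: 'I_k * bool} | compatible l m],
                            w <- words_from n' m]
  else [::].

Lemma words_fromP n l w : w \in words_from n l ->
  reduced_word w /\ exists w', w = l :: w'.
Proof.
elim: n l w => // n IH l w; rewrite inE => /predU1P[->|].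
  by split; last exists [::].
move=> /allpairsPdep[m [w1 [ml /IH[red [w2 ew]] ->]]]; split; last by exists w1.
move: ml red; rewrite mem_filter ew => /andP[lm _] /= ->.
by rewrite andbT.
Qed.

Lemma words_from_uniq n l : uniq (words_from n l).
Proof.
elim: n l => // n IH l /=; apply/andP; split.
  apply/negP => /allpairsPdep[m [w [_ /words_fromP[_ [w' ->]] //]]].
apply: allpairs_uniq_dep => //; first by rewrite filter_uniq ?enum_uniq.
move=> [m w] [m' w'] /allpairsPdep[x [y [_ hy [-> ->]]]].
move=> /allpairsPdep[x' [y' [_ hy' [-> ->]]]] [eyy].
have [_ [z ez]] := words_fromP hy; have [_ [z' ez']] := words_fromP hy'.
by move: eyy; rewrite ez ez' => -[-> ->].
Qed.

Variable G : groupType.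
Variable a : 'I_k -> G.

Lemma letter_value_inverse l :
  letter_value a (inverse_letter l) = ((letter_value a l)^-1)%g.
Proof. by case: l => i [] //=; rewrite /letter_value /= invgK. Qed.

Lemma prod_inverse_word w :
  (\prod_(l <- rev (map inverse_letter w)) letter_value a l =
   (\prod_(l <- w) letter_value a l)^-1)%g.
Proof.
elim: w => [|l w IH]; first by rewrite !big_nil invg1.
rewrite map_cons rev_cons -cats1 big_cat big_seq1 big_cons IH invgM.
by rewrite letter_value_inverse.
Qed.

Lemma reduced_inverse_word w :
  reduced_word w -> reduced_word (rev (map inverse_letter w)).
Proof.
rewrite /reduced_word rev_sorted sorted_map; apply: sub_sorted => l m /=.
by rewrite eq_sym; case: l m => [i []] [j []] /=; case: (j == i).
Qed.

(** Free generation only speaks of words equal to 1.  After cancelling a common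
prefix, the first letters of [w] and [w'] differ, so that the inverse of [w]
followed by [w'] is a reduced word, and its value is 1. *)
Lemma reduced_word_prod_inj w w' : freely_generating a ->
  reduced_word w -> reduced_word w' ->
  (\prod_(l <- w) letter_value a l = \prod_(l <- w') letter_value a l)%g -> w = w'.
Proof.
move=> free; elim: w w' => [|l w IH] [|m w'] //.
- by move=> _ red; rewrite big_nil => /esym /(free _ red).
- by move=> red _; rewrite [in RHS]big_nil => /(free _ red).
move=> red red' e; have [elm|nlm] := eqVneq l m.
  subst m; congr (_ :: _); apply: IH; [exact: path_sorted red|exact: path_sorted red'|].
  by move: e; rewrite !big_cons => /mulgI.
suff : rev (map inverse_letter (l :: w)) ++ m :: w' = [::].
  by case: (rev _).
apply: free; last by rewrite big_cat prod_inverse_word e; exact: mulVg.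
have lm : compatible (inverse_letter l) m.
  by rewrite compatibleE /inverse_letter /= negbK -surjective_pairing eq_sym.
have := reduced_inverse_word red; rewrite /reduced_word map_cons rev_cons.
case: (rev _) => [_|x s]; rewrite /= ?cat_path /=.
  by rewrite [path _ _ _]red' andbT.
by move=> ->; rewrite last_rcons /= [path _ _ _]red' andbT.
Qed.

Lemma subgroup_prod_word (H : set G) w : is_subgroup H -> (forall i, H (a i)) ->
  H (\prod_(l <- w) letter_value a l)%g.
Proof.
move=> hH ha; rewrite -in_setE; elim: w => [|l w IH].
  by rewrite big_nil; have [] := hH.
rewrite big_cons; apply: (group_closedM hH) => //.
rewrite /letter_value; case: ifP => _; first by rewrite inE.
by apply: (group_closedV hH); rewrite inE.
Qed.

End Reduced_words.

(** * Summing over reduced words *)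

Section Word_length.
Variables (R : realType) (k : nat) (t rho : 'I_k -> R).
Implicit Types (l m : 'I_k * bool) (w : seq ('I_k * bool)).

(** The cost of reaching the axis of [l] from [o] and returning is charged to the
last letter of each syllable: [w] is what follows [l]. *)
Definition detour l w : R :=
  if w is m :: _ then if l.1 == m.1 then 0 else 2 * rho l.1 else 2 * rho l.1.

Fixpoint word_length w : R :=
  if w is l :: w' then t l.1 + detour l w' + word_length w' else 0.

Lemma mdist_word_le (X : metricType R) (o : X) (a : 'I_k -> isom X) (y : 'I_k -> X) w :
  (forall i, mdist (y i) (a i (y i)) <= t i) -> (forall i, rho i = mdist o (y i)) ->
  mdist o ((\prod_(l <- w) letter_value a l)%g o) <= word_length w.
Proof.
move=> ht hr.
have letter l : mdist (y l.1) (letter_value a l (y l.1)) <= t l.1.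
  rewrite /letter_value; case: ifP => _ //.
  by rewrite -{1}(isom_invK (a l.1) (y l.1)) isom_dist metric_sym.
case: w => [|l w]; first by rewrite big_nil mdistxx.
(* Starting from [y l] instead of [o] saves [rho l] and makes the induction
   work inside a syllable, where the path never returns to [o]. *)
suff H : mdist (y l.1) ((\prod_(l <- l :: w) letter_value a l)%g o) <=
    word_length (l :: w) - rho l.1.
  by apply: le_trans (metric_triangle _ (y l.1) _) _; rewrite -hr; lra.
elim: w l => [|m w IH] l; rewrite big_cons isom_mulE.
  rewrite big_nil /= addr0.
  apply: le_trans (metric_triangle _ (letter_value a l (y l.1)) _) _.
  have e1 : mdist (y l.1) ((1%g : isom X) o) = rho l.1 by rewrite metric_sym hr.
  by rewrite isom_dist e1; have := letter l; lra.
apply: le_trans (metric_triangle _ (letter_value a l (y l.1)) _) _.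
rewrite isom_dist; have := letter l; have := IH m.
set P := (\prod_(_ <- _) _)%g.
set L := word_length (m :: w) => IHm ll.
rewrite (_ : word_length _ = t l.1 + detour l (m :: w) + L) //=.
have [e|_] := eqVneq; first by rewrite addr0 -addrA lerD // e.
have := metric_triangle (y l.1) o (P o); have := metric_triangle o (y m.1) (P o).
by rewrite (metric_sym (y l.1) o) -!hr; lra.
Qed.

End Word_length.

Section Word_series.
Variables (R : realType) (k : nat) (t rho : 'I_k -> R) (s : R).
Implicit Types (l m : 'I_k * bool) (w : seq ('I_k * bool)).

Definition weight w : R := expR (- s * word_length t rho w).

Definition partial_sum (n : nat) l : R := \sum_(w <- words_from n l) weight w.

Let u i := expR (- s * t i).
Let v i := expR (- 2 * s * rho i).

Let u_gt0 i : 0 < u i. Proof. exact: expR_gt0. Qed.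
Let v_gt0 i : 0 < v i. Proof. exact: expR_gt0. Qed.

Lemma partial_sum0 l : partial_sum 0 l = 0.
Proof. by rewrite /partial_sum big_nil. Qed.

(** Remove the first letter: if the next one has the same index it must be [l]
itself and the syllable goes on, otherwise a syllable ends and the detour is
paid. *)
Lemma partial_sumS n l : partial_sum n.+1 l =
  u l.1 * (partial_sum n l +
           v l.1 * (1 + \sum_(m | m.1 != l.1) partial_sum n m)).
Proof.
rewrite {1}/partial_sum big_cons big_allpairs_dep big_filter.
have -> : weight [:: l] = u l.1 * v l.1.
  by rewrite /weight /= -expRD; congr expR; ring.
have step m : \sum_(w <- words_from n m) weight (l :: w) =
    u l.1 * (if l.1 == m.1 then 1 else v l.1) * partial_sum n m.
  rewrite /partial_sum big_distrr big_seq_cond [RHS]big_seq_cond /=.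
  apply: eq_bigr => w /andP[/words_fromP[_ [w' ->]] _].
  rewrite /weight /=; case: eqP => _; rewrite ?mulr1 -!expRD; congr expR; ring.
under eq_bigr do rewrite step.
rewrite big_enum_cond (bigD1 l) /=; last first.
  by rewrite compatibleE; case: l {step} => i b; rewrite xpair_eqE eqxx; case: b.
rewrite eqxx (eq_bigl (fun m => m.1 != l.1)); last first.
  move=> m; rewrite compatibleE; case: l m {step} => [i b] [j c] /=.
  by rewrite !xpair_eqE /=; case: (j == i) => //=; case: b c => [] [].
rewrite (eq_bigr (fun m => u l.1 * v l.1 * partial_sum n m)); last first.
  by move=> m; rewrite eq_sym => /negPf ->.
rewrite -big_distrr /=; ring.
Qed.

Lemma weight_gt0 w : 0 < weight w.
Proof. exact: expR_gt0. Qed.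

Lemma partial_sum_ge0 n l : 0 <= partial_sum n l.
Proof. by apply: sumr_ge0 => w _; exact/ltW/weight_gt0. Qed.

Lemma partial_sum_nondecreasing l :
  nondecreasing_seq (partial_sum ^~ l).
Proof.
apply/nondecreasing_seqP => n; elim: n l => [|n IH] l.
  by rewrite partial_sum0 partial_sum_ge0.
rewrite [leLHS]partial_sumS [leRHS]partial_sumS ler_wpM2l ?(ltW (u_gt0 _)) // lerD ?IH //.
by rewrite ler_wpM2l ?(ltW (v_gt0 _)) // lerD2l ler_sum.
Qed.

(** With [q i] the mass of the words beginning with a power of [a i] and [Q] the
total mass, including 1 for the empty word, the system reads
[q i * (1 - u i) = 2 * u i * v i * (Q - q i)].  Hence the [i]-th term is
[q i / Q], and these fractions sum to [(Q - 1) / Q]. *)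
Lemma axis_sum_le1_of_fixpoint (p : 'I_k * bool -> R) :
  (forall l, 0 <= p l) -> (forall i, u i < 1) ->
  (forall l, p l = u l.1 * (p l + v l.1 * (1 + \sum_(m | m.1 != l.1) p m))) ->
  \sum_i (2 * v i) / ((u i)^-1 - 1 + 2 * v i) <= 1.
Proof.
move=> p0 u1 hp; pose q i := p (i, true) + p (i, false).
have sumE i : \sum_(m | m.1 != i) p m = \sum_(j | j != i) q j.
  transitivity (\sum_(j | j != i) \sum_b p (j, b)).
    by rewrite pair_big /=; apply: eq_big => -[j b] //=; rewrite andbT.
  by apply: eq_bigr => j _; rewrite big_bool.
pose Q := 1 + \sum_i q i.
have q0 i : 0 <= q i by rewrite addr_ge0.
have Q1 : 1 <= Q by rewrite lerDl sumr_ge0.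
have Q0 : 0 < Q := lt_le_trans ltr01 Q1.
have qE i : q i * (1 - u i) = 2 * u i * v i * (Q - q i).
  have := hp (i, true); have := hp (i, false); rewrite /= !sumE.
  have -> : Q = 1 + \sum_(j | j != i) q j + q i.
    by rewrite /Q (bigD1 i) //=; ring.
  rewrite /q; move: (\sum_(j | j != i) _) => S ef et.
  have -> : p (i, true) + p (i, false) = 2 * p (i, true) +
      (p (i, false) - p (i, true)) by ring.
  lra.
have termE i : (2 * v i) / ((u i)^-1 - 1 + 2 * v i) = q i / Q.
  have ui := u_gt0 i; have vi := v_gt0 i.
  have uV : 1 < (u i)^-1 by rewrite invf_gt1.
  apply/eqP; rewrite eqr_div ?lt0r_neq0 //; last first.
    by rewrite addr_gt0 ?subr_gt0 ?mulr_gt0.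
  apply/eqP; apply: (mulfI (lt0r_neq0 ui)).
  transitivity (q i * (u i / u i - u i) + 2 * u i * v i * q i); last ring.
  rewrite divff ?lt0r_neq0 // qE; ring.
rewrite (eq_bigr _ (fun i _ => termE i)) -mulr_suml ler_pdivrMr // mul1r.
by rewrite lerDr.
Qed.

Lemma word_series_bound (M : R) : 0 < s -> (forall i, 0 < t i) ->
  (forall n l, partial_sum n l <= M) ->
  \sum_i (2 * v i) / (expR (s * t i) - 1 + 2 * v i) <= 1.
Proof.
move=> s0 t0 hM.
have cv l : cvgn (partial_sum ^~ l).
  apply: nondecreasing_is_cvgn (partial_sum_nondecreasing l) _.
  by exists M => _ [n _ <-].
pose p l := limn (partial_sum ^~ l).
have cp l : (partial_sum ^~ l) @ \oo --> p l := cv l.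
have uE i : expR (s * t i) = (u i)^-1 by rewrite /u mulNr expRN invrK.
under eq_bigr do rewrite uE.
apply: (@axis_sum_le1_of_fixpoint p).
- by move=> l; apply: limr_ge => //; near=> n; exact: partial_sum_ge0.
- by move=> i; rewrite /u expR_lt1 mulNr oppr_lt0 mulr_gt0.
move=> l; apply: (cvg_unique (@norm_hausdorff _ R^o)
  (F := (partial_sum n.+1 l) @[n --> \oo])).
  by have := cp l; rewrite -cvg_shiftS.
rewrite /= (funext (fun n => partial_sumS n l)).
apply: cvgMl_tmp; apply: cvgD; first exact: cp.
apply: cvgMl_tmp; apply: cvgD; first exact: cvg_cst.
apply: cvg_big => [|m _]; [exact: add_continuous|exact: cp].
Unshelve. all: by end_near. Qed.

End Word_series.

(** * Poincare series *)

Section Poincare_series.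
Variable R : realType.

(** The form in which convergence of the Poincare series is used: as a bound on
finite sums of real numbers. *)
Lemma ler_sum_esum (T : choiceType) (A : set T) (f : T -> R) (r : seq T) :
  (forall x, 0 <= f x) -> uniq r -> (forall x, x \in r -> A x) ->
  (\esum_(x in A) (f x)%:E < +oo)%E ->
  \sum_(x <- r) f x <= fine (\esum_(x in A) (f x)%:E).
Proof.
move=> f0 ur rA foo.
have e0 : (0 <= \esum_(x in A) (f x)%:E)%E by apply: esum_ge0 => x _; rewrite lee_fin.
rewrite -lee_fin fineK ?ge0_fin_numE //; apply: esum_ge; exists [set` r].
  by split=> [//|x /=]; exact: rA.
by rewrite -fsbig_seq // sumEFin.
Qed.

Lemma esum_dominated (T : choiceType) (A : set T) (f f' : T -> R) (C : R) :
  (forall x, 0 <= f x) -> 0 <= C -> (forall x, f' x <= C * f x) ->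
  (\esum_(x in A) (f x)%:E < +oo)%E -> (\esum_(x in A) (f' x)%:E < +oo)%E.
Proof.
move=> f0 C0 ff' foo.
apply: le_lt_trans (ltry (C * fine (\esum_(x in A) (f x)%:E))).
apply: ge_ereal_sup => _ [F [Ffin FA] <-].
rewrite fsbig_finite // sumEFin lee_fin.
apply: le_trans (ler_sum _ (fun x _ => ff' x)) _.
rewrite -mulr_sumr ler_wpM2l // ler_sum_esum // => x.
by rewrite in_fset_set // inE => /FA.
Qed.

Variable X : metricType R.
Implicit Types (Gamma : set (isom X)) (o y : X).

(** Changing the base point changes each distance by at most
[2 * mdist o y], hence each series by a bounded factor. *)
Lemma critical_exponent_basepoint Gamma o y :
  critical_exponent o Gamma = critical_exponent y Gamma.
Proof.
rewrite /critical_exponent; congr ereal_inf; congr image.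
have H p q (s : R) : 0 < s ->
    (\esum_(g in Gamma) (expR (- s * mdist p (g p)))%:E < +oo)%E ->
    (\esum_(g in Gamma) (expR (- s * mdist q (g q)))%:E < +oo)%E.
  move=> s0; apply: (@esum_dominated _ _ _ _ (expR (s * (2 * mdist p q)))).
  - by move=> g; exact: expR_ge0.
  - exact: expR_ge0.
  - move=> g; rewrite -expRD ler_expR; have := mdist_displacement g p q.
    move: (mdist p (g p)) (mdist q (g q)) (mdist p q) => x z d h.
    have : s * x <= s * (z + 2 * d) by rewrite ler_pM2l.
    lra.
by apply/seteqP; split=> s /= [s0 hs]; split=> //; exact: H hs.
Qed.

Lemma critical_exponent_approx Gamma o (e : R) :
  (0 < critical_exponent o Gamma < +oo)%E -> 0 < e ->
  exists s : R, [/\ 0 < s, s <= fine (critical_exponent o Gamma) + e &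
    (\esum_(g in Gamma) (expR (- s * mdist o (g o)))%:E < +oo)%E].
Proof.
move=> /andP[c0 coo] e0.
have cfin : critical_exponent o Gamma \is a fin_num by rewrite ge0_fin_numE // ltW.
have [_ [s [s0 hs] <-] lts] := lb_ereal_inf_adherent e0 cfin.
exists s; split=> //.
by rewrite -lee_fin EFinD fineK // ltW.
Qed.

Lemma free_poincare_bound Gamma o (k : nat) (a : 'I_k -> isom X)
    (y : 'I_k -> X) (t : 'I_k -> R) (s : R) :
  is_subgroup Gamma -> (forall i, Gamma (a i)) -> freely_generating a ->
  (forall i, mdist (y i) (a i (y i)) <= t i) -> (forall i, 0 < t i) -> 0 < s ->
  (\esum_(g in Gamma) (expR (- s * mdist o (g o)))%:E < +oo)%E ->
  \sum_i (2 * expR (- 2 * s * mdist o (y i))) /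
    (expR (s * t i) - 1 + 2 * expR (- 2 * s * mdist o (y i))) <= 1.
Proof.
move=> hG aG free ht t0 s0 hs.
pose rho i := mdist o (y i).
apply: (@word_series_bound _ _ t rho _
  (fine (\esum_(g in Gamma) (expR (- s * mdist o (g o)))%:E))) => // n l.
pose ev w : isom X := (\prod_(l <- w) letter_value a l)%g.
apply: (@le_trans _ _ (\sum_(g <- map ev (words_from n l)) expR (- s * mdist o (g o)))).
  rewrite big_map; apply: ler_sum => w _.
  rewrite /weight ler_expR !mulNr lerN2 ler_pM2l //.
  exact: (mdist_word_le _ ht).
apply: ler_sum_esum => //.
- rewrite map_inj_in_uniq ?words_from_uniq // => w w'.
  move=> /words_fromP[rw _] /words_fromP[rw' _].
  exact: reduced_word_prod_inj.
- by move=> _ /mapP[w _ ->]; exact: subgroup_prod_word.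
Qed.

End Poincare_series.

(** * Passing to the critical exponent *)

Section Axis_term.
Variable R : realType.
Implicit Types (d r t e : R).

Definition axis_term d t r : R :=
  (2 * expR (- 2 * d * r)) / (expR (d * t) - 1 + 2 * expR (- 2 * d * r)).

Lemma axis_term_denom_gt0 d t r : 0 < d -> 0 < t ->
  0 < expR (d * t) - 1 + 2 * expR (- 2 * d * r).
Proof.
move=> d0 t0; rewrite addr_gt0 ?mulr_gt0 ?expR_gt0 // subr_gt0 expR_gt1.
exact: mulr_gt0.
Qed.

(** This monotonicity lets approximations of the exponent and of the distances
from above be replaced by values that depend on a single small parameter. *)
Lemma le_axis_term d t r d' t' r' : 0 < d -> d <= d' -> 0 < t -> t <= t' ->
  0 <= r -> r <= r' -> axis_term d' t' r' <= axis_term d t r.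
Proof.
move=> d0 dd' t0 tt' r0 rr'.
have d'0 := lt_le_trans d0 dd'; have t'0 := lt_le_trans t0 tt'.
have := axis_term_denom_gt0 r d0 t0; have := axis_term_denom_gt0 r' d'0 t'0.
have : expR (- 2 * d' * r') <= expR (- 2 * d * r).
  by rewrite ler_expR !mulNr lerN2 ler_pM // ?mulr_ge0 ?ler_pM2l // ltW.
have : expR (d * t) <= expR (d' * t') by rewrite ler_expR ler_pM // ltW.
have : 1 <= expR (d * t) by rewrite -expR0 ler_expR mulr_ge0 // ltW.
have : 0 <= expR (- 2 * d' * r') by exact: expR_ge0.
rewrite /axis_term.
move: (expR (d * t)) (expR (d' * t')) (expR (- 2 * d * r)) (expR (- 2 * d' * r')).
move=> w w' v v' v'0 w1 ww' v'v D'0 D0.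
rewrite ler_pdivrMr // mulrAC ler_pdivlMr //.
have : v' * (w - 1) <= v * (w' - 1) by rewrite ler_pM //; lra.
by lra.
Qed.

Lemma axis_term_cvg d t r : 0 < d -> 0 < t ->
  axis_term (d + e) t (r + e) @[e --> 0^'+] --> axis_term d t r.
Proof.
move=> d0 t0.
have ce c : c + e @[e --> 0^'+] --> c.
  rewrite -[X in _ --> X]addr0; apply: cvgD; first exact: cvg_cst.
  by apply: cvg_at_right_filter; exact: cvg_id.
have cv : expR (- 2 * (d + e) * (r + e)) @[e --> 0^'+] --> expR (- 2 * d * r).
  apply: continuous_cvg; first exact: continuous_expR.
  apply: cvgM; last exact: ce.
  by apply: cvgM; [exact: cvg_cst|exact: ce].
have c2v : 2 * expR (- 2 * (d + e) * (r + e)) @[e --> 0^'+] --> 2 * expR (- 2 * d * r).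
  by apply: cvgM; [exact: cvg_cst|exact: cv].
apply: cvgM => //; apply: cvgV; first exact/lt0r_neq0/axis_term_denom_gt0.
apply: cvgD => //; apply: cvgB; last exact: cvg_cst.
apply: continuous_cvg; first exact: continuous_expR.
by apply: cvgM; [exact: ce|exact: cvg_cst].
Qed.

(** Clearing denominators gives
[2 * k - 2 <= (expR (d * t) - 1) * expR (2 * d * r)], and the last factor is at
least 1. *)
Lemma log_le_of_axis_term k d t r : (0 < k)%N -> 0 < d -> 0 < t -> 0 <= r ->
  k%:R * axis_term d t r <= 1 -> ln ((2 * k)%:R - 1) <= d * (t + 2 * r).
Proof.
move=> k0 d0 t0 r0; rewrite /axis_term mulrA.
rewrite ler_pdivrMr ?axis_term_denom_gt0 // mul1r => h.
have k1 : 1 <= k%:R :> R by rewrite ler1n.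
rewrite -ler_expR natrM lnK ?posrE; last by lra.
have e1 : expR (- 2 * d * r) * expR (2 * d * r) = 1.
  by rewrite -expRD !mulNr addNr expR0.
have e2 : expR (d * (t + 2 * r)) = expR (d * t) * expR (2 * d * r).
  by rewrite -expRD; congr expR; ring.
have x1 : 1 <= expR (2 * d * r).
  by rewrite -expR0 ler_expR !mulr_ge0 // ltW.
have x0 : 0 <= expR (2 * d * r) by exact: expR_ge0.
move: (ler_wpM2r x0 h) x1 e1; rewrite e2.
move: (expR (d * t)) (expR (- 2 * d * r)) (expR (2 * d * r)) => w v x H x1 e1.
have -> : w * x = (w - 1 + 2 * v) * x + x - 2 * (v * x) by ring.
have : k%:R * (2 * v) * x = 2 * k%:R by rewrite -[RHS]mulr1 -e1; ring.
by rewrite e1; lra.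
Qed.

End Axis_term.

Section Axes_of_free_generators.
Variables (R : realType) (X : metricType R).
Hypothesis hCAT : CAT_minus1 X.

Lemma axis_neq0 (g : isom X) : axial g -> exists y, axis g y.
Proof. by move=> /(axisP hCAT)[[c _ ->] _]; exists (c 0); exists 0. Qed.

Lemma dist_set_ge0 (x : X) (A : set X) : 0 <= dist_set x A.
Proof.
rewrite /dist_set; have [->|/set0P ne] := eqVneq [set mdist x y | y in A] set0.
  by rewrite inf0.
by apply: lb_le_inf => // _ [y _ <-]; exact: mdist_ge0.
Qed.

Lemma dist_axis_approx (g : isom X) (o : X) (e : R) : axial g -> 0 < e ->
  exists2 y, axis g y & mdist o y < dist_set o (axis g) + e.
Proof.
move=> ag e0; have [z az] := axis_neq0 ag.
have hi : has_inf [set mdist o y | y in axis g].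
  split; first by exists (mdist o z); exists z.
  by exists 0 => _ [y _ <-]; exact: mdist_ge0.
by have [_ [y ay <-] lty] := inf_adherent e0 hi; exists y.
Qed.

Variables (Gamma : set (isom X)) (k : nat) (a : 'I_k -> isom X).
Hypotheses (hsub : is_subgroup Gamma) (haGamma : forall i, Gamma (a i)).
Hypotheses (haxial : forall i, axial (a i)) (hfree : freely_generating a).

(** For each [e > 0] there are a convergent exponent [s <= d + e] and points of the
axes at distance less than [dist_set o _ + e] from [o]; by monotonicity the sum
at [d + e] and [dist_set o _ + e] is at most 1, and [e] tends to 0. *)
Lemma sum_axis_term_le1 (o : X) :
  (0 < critical_exponent o Gamma < +oo)%E ->
  \sum_i axis_term (fine (critical_exponent o Gamma)) (translation_length (a i))
    (dist_set o (axis (a i))) <= 1.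
Proof.
move=> hd; set d := fine _.
have d0 : 0 < d by exact: fine_gt0.
have t0 i : 0 < translation_length (a i) := (haxial i).1.
pose h e := \sum_i axis_term (d + e) (translation_length (a i))
  (dist_set o (axis (a i)) + e).
have hcv : h e @[e --> 0^'+] --> \sum_i axis_term d (translation_length (a i))
    (dist_set o (axis (a i))).
  apply: cvg_big => [|i _]; [exact: add_continuous|exact: axis_term_cvg].
rewrite -(cvg_lim _ hcv) //; apply: limr_le; first by apply/cvg_ex; eexists; exact: hcv.
near=> e.
have e0 : 0 < e by near: e; exact: nbhs_right_gt.
have [s [s0 sd hs]] := critical_exponent_approx hd e0.
have /choice[y hy] : forall i, exists y,
    axis (a i) y /\ mdist o y < dist_set o (axis (a i)) + e.
  by move=> i; have [y ay lty] := dist_axis_approx o (haxial i) e0; exists y.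
have ht i : mdist (y i) (a i (y i)) <= translation_length (a i).
  by rewrite (mdist_axis hCAT (haxial i)) //; have [] := hy i.
apply: le_trans (free_poincare_bound hsub haGamma hfree ht t0 s0 hs).
apply: ler_sum => i _; apply: le_axis_term => //; first exact: mdist_ge0.
exact/ltW/(hy i).2.
Unshelve. all: by end_near. Qed.

Lemma log_le_of_near_axes (o x : X) (T D : R) : (0 < k)%N ->
  (0 < critical_exponent o Gamma < +oo)%E ->
  (forall i, translation_length (a i) <= T) ->
  (forall i, dist_set x (axis (a i)) <= D) ->
  ln ((2 * k)%:R - 1) <= fine (critical_exponent o Gamma) * (T + 2 * D).
Proof.
move=> k0 hd hT hD; have hx := hd.
rewrite (critical_exponent_basepoint Gamma o x) in hx *.
have d0 := fine_gt0 hx.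
have T0 : 0 < T := lt_le_trans (haxial (Ordinal k0)).1 (hT _).
have D0 : 0 <= D := le_trans (dist_set_ge0 _ _) (hD (Ordinal k0)).
apply: log_le_of_axis_term => //; apply: le_trans (sum_axis_term_le1 hx).
rewrite mulr_natl -[X in _ *+ X]card_ord -sumr_const; apply: ler_sum => i _.
by apply: le_axis_term => //; [exact: (haxial i).1|exact: dist_set_ge0].
Qed.

End Axes_of_free_generators.

(** * The inequalities for free axial generators *)

Theorem corollary1p10 (R : realType) (X : metricType R)
  (hproper : proper_space X) (hCAT : CAT_minus1 X)
  (Gamma : set (isom X)) (o : X)
  (hsub : is_subgroup Gamma) (hfg : finitely_generated Gamma)
  (hne : non_elementary o Gamma) (hdiscr : discrete_isoms Gamma)
  (hdelta : (0 < critical_exponent o Gamma < +oo)%E)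
  (k : nat) (hk : (2 <= k)%N) (a : 'I_k -> isom X)
  (haGamma : forall i, Gamma (a i)) (haxial : forall i, axial (a i))
  (hfree : freely_generating a) :
  let delta := fine (critical_exponent o Gamma) in
  let tau i := translation_length (a i) in
  let r i := dist_set o (axis (a i)) in
  [/\ \sum_(i < k) (2 * expR (- 2 * delta * r i)) /
        (expR (delta * tau i) - 1 + 2 * expR (- 2 * delta * r i)) <= 1,
      forall T D : R, (forall i, tau i <= T) ->
        (exists x : X, forall i, dist_set x (axis (a i)) <= D) ->
        ln ((2 * k)%:R - 1) <= delta * (T + 2 * D) &
      forall T : R, (forall i, tau i <= T) ->
        let D := inf [set \big[Num.max/0]_(i < k) dist_set y (axis (a i))
                     | y in [set: X]] in
        ln ((2 * k)%:R - 1) <= delta * (T + 2 * D)].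
Proof.
move=> delta tau r; have k0 : (0 < k)%N by exact: leq_trans hk.
have d0 : 0 < delta by exact: fine_gt0.
split.
- exact: (sum_axis_term_le1 hCAT hsub haGamma haxial hfree hdelta).
- move=> T D hT [x hx].
  exact: (log_le_of_near_axes hCAT hsub haGamma haxial hfree (x := x)).
move=> T hT /=; set S := [set _ | y in _].
have boundE D : (ln ((2 * k)%:R - 1) <= delta * (T + 2 * D)) =
    ((ln ((2 * k)%:R - 1) / delta - T) / 2 <= D).
  rewrite ler_pdivrMr // lerBlDr ler_pdivrMr // (mulrC _ delta).
  by rewrite (mulrC D) (addrC _ T).
rewrite boundE; apply: lb_le_inf.
  by exists (\big[Num.max/0]_(i < k) dist_set o (axis (a i))), o.
move=> _ [x _ <-]; rewrite -boundE.
apply: (log_le_of_near_axes hCAT hsub haGamma haxial hfree (x := x)) => // i.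
exact: le_bigmax_cond.
Qed.
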